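(* Let $(M,g)$ be a tangential hypersurface, with unit normal vector field $N$, of a locally product-like statistical manifold $(\widetilde{M},\widetilde{g},\widetilde{\nabla},F)$. Then for all $X,Y\in\Gamma(TM)$: $$R(X,Y)\xi=-\varphi\big((\overline{\nabla}_{X}A)_{N}Y\big)+\varphi\big((\overline{\nabla}_{Y}A)_{N}X\big)-\eta^{\ast}(A_{N}Y)A_{N}X+\eta^{\ast}(A_{N}X)A_{N}Y-\{g([A_{N},A^{\ast}_{N}]X,Y)-(d\kappa)(X,Y)\}\xi,$$ $$R^{\ast}(X,Y)\xi^{\ast}=-\varphi^{\ast}\big((\overline{\nabla}^{\ast}_{X}A^{\ast})_{N}Y\big)+\varphi^{\ast}\big((\overline{\nabla}^{\ast}_{Y}A^{\ast})_{N}X\big)-\eta(A^{\ast}_{N}Y)A^{\ast}_{N}X+\eta(A^{\ast}_{N}X)A^{\ast}_{N}Y+\{g([A_{N},A^{\ast}_{N}]X,Y)-(d\kappa)(X,Y)\}\xi^{\ast}.$$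
   Context: A statistical manifold $(\widetilde{M},\widetilde{g},\widetilde{\nabla})$ is a Riemannian manifold with a torsion-free affine connection $\widetilde{\nabla}$ such that $\widetilde{\nabla}\widetilde{g}$ is totally symmetric. The dual connection $\widetilde{\nabla}^{\ast}$ is defined by $Z\widetilde{g}(X,Y)=\widetilde{g}(X,\widetilde{\nabla}^{\ast}_{Z}Y)+\widetilde{g}(\widetilde{\nabla}_{Z}X,Y)$; it is also torsion-free. A locally product-like statistical manifold $(\widetilde{M},\widetilde{g},\widetilde{\nabla},F)$ is a statistical manifold with a $(1,1)$-tensor field $F$ satisfying $F^{2}=I$ and $\widetilde{\nabla}F=0$, together with the $(1,1)$-tensor field $F^{\ast}$ satisfying $\widetilde{g}(FX,Y)=\widetilde{g}(X,F^{\ast}Y)$. A hypersurface $(M,g)$ (induced metric $g$, unit normal $N$) is tangential if $FN$ and $F^{\ast}N$ are tangent to $M$. Then put $\xi=FN$, $\xi^{\ast}=F^{\ast}N$, and for $X\in\Gamma(TM)$ write $FX=\varphi X+\eta^{\ast}(X)N$, $F^{\ast}X=\varphi^{\ast}X+\eta(X)N$ with $\varphi X,\varphi^{\ast}X$ tangent to $M$ and $\eta,\eta^{\ast}$ $1$-forms on $M$ (so $\eta(X)=g(X,\xi)$, $\eta^{\ast}(X)=g(X,\xi^{\ast})$). The Gauss and Weingarten formulas, for $X,Y\in\Gamma(TM)$, are $$\widetilde{\nabla}_{X}Y=\nabla_{X}Y+g(A^{\ast}_{N}X,Y)N,\quad \widetilde{\nabla}_{X}N=-A_{N}X+\kappa(X)N,$$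 $$\widetilde{\nabla}^{\ast}_{X}Y=\nabla^{\ast}_{X}Y+g(A_{N}X,Y)N,\quad \widetilde{\nabla}^{\ast}_{X}N=-A^{\ast}_{N}X-\kappa(X)N,$$ which define the induced connections $\nabla,\nabla^{\ast}$ on $M$, the shape operators $A_{N},A^{\ast}_{N}$ and the $1$-form $\kappa$ on $M$. $R$ and $R^{\ast}$ are the curvature tensors of $\nabla$ and $\nabla^{\ast}$, with $R(X,Y)Z=\nabla_{X}\nabla_{Y}Z-\nabla_{Y}\nabla_{X}Z-\nabla_{[X,Y]}Z$. Moreover $$(\overline{\nabla}_{X}A)_{N}Y=\nabla_{X}(A_{N}Y)-\kappa(X)A_{N}Y-A_{N}(\nabla_{X}Y),$$ $$(\overline{\nabla}^{\ast}_{X}A^{\ast})_{N}Y=\nabla^{\ast}_{X}(A^{\ast}_{N}Y)+\kappa(X)A^{\ast}_{N}Y-A^{\ast}_{N}(\nabla^{\ast}_{X}Y),$$ $(d\kappa)(X,Y)=(\nabla_{X}\kappa)(Y)-(\nabla_{Y}\kappa)(X)$ with $(\nabla_{X}\kappa)(Y)=X\{\kappa(Y)\}-\kappa(\nabla_{X}Y)$, and $[A_{N},A^{\ast}_{N}]=A_{N}A^{\ast}_{N}-A^{\ast}_{N}A_{N}$. *)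

(* Defs.v *)
From HB Require Import structures.
From mathcomp Require Import all_boot all_order all_algebra.
From mathcomp Require Import all_classical all_reals all_analysis.
Import Order.TTheory GRing.Theory Num.Theory numFieldNormedType.Exports.

Set Implicit Arguments.
Unset Strict Implicit.
Unset Printing Implicit Defensive.

Local Open Scope classical_set_scope.
Local Open Scope ring_scope.

(* [U] is meant to be open. *)
Fixpoint Ck_on (R : realType) (V W : normedModType R) (k : nat)
    (U : set V) (f : V -> W) : Prop :=
  match k with
  | 0 => forall x, U x -> {for x, continuous f}
  | k'.+1 => (forall x, U x -> differentiable f x) /\
             (forall v : V, Ck_on k' U (fun x => 'd f x v))
  end.

Definition smooth_on (R : realType) (V W : normedModType R)
    (U : set V) (f : V -> W) : Prop := forall k, Ck_on k U f.

Definition smooth_near (R : realType) (V W : normedModType R)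
    (f : V -> W) (x : V) : Prop :=
  exists U : set V, [/\ open U, U x & smooth_on U f].

(* [chart_inv] is only meaningful on the image of [chart_dom]. *)
Record chart (R : realType) (T : topologicalType) (n : nat) := Chart {
  chart_dom : set T;
  chart_map :> T -> 'rV[R]_n;
  chart_inv : 'rV[R]_n -> T;
  chart_dom_open : open chart_dom;
  chart_img_open : open (chart_map @` chart_dom);
  chart_mapK : forall p, chart_dom p -> chart_inv (chart_map p) = p;
  chart_map_cont : forall p, chart_dom p -> {for p, continuous chart_map};
  chart_inv_cont : forall x, (chart_map @` chart_dom) x ->
    {for x, continuous chart_inv}
}.

(* The smooth structure is given by an atlas indexed by the points of the
   manifold: [chart_at p] is a chart around [p]. Every atlas contains a
   subatlas of this form, and the latter determines the smooth structure. *)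
Record manifold (R : realType) (n : nat) := Manifold {
  carrier :> topologicalType;
  chart_at : carrier -> chart R carrier n;
  manifold_hausdorff : hausdorff_space carrier;
  manifold_countable : @second_countable carrier;
  chart_at_dom : forall p, chart_dom (chart_at p) p;
  chart_at_compat : forall p q,
    smooth_on (chart_at p @` (chart_dom (chart_at p) `&` chart_dom (chart_at q)))
      (chart_at q \o chart_inv (chart_at p))
}.

(* T_pM is represented by 'rV[R]_n through the coordinates of the preferred
   chart [chart_at p]: a vector field on M is a map M -> 'rV[R]_n and a vector
   field along f : M -> M' is a map M -> 'rV[R]_m. The value of a field at q is
   thus expressed in [chart_at q], and must be moved to a fixed chart before
   being differentiated or tested for smoothness: this is what [vcoord] does. *)

(* Coordinates in [chart_at p] of the vector v of T_qM (q near p). *)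
Definition vcoord (R : realType) (n : nat) (M : manifold R n) (p q : M)
    (v : 'rV[R]_n) : 'rV[R]_n :=
  'd (chart_at p \o chart_inv (chart_at q)) (chart_at q q) v.

(* The coordinate field d/dx^j of [chart_at p]. *)
Definition coord_field (R : realType) (n : nat) (M : manifold R n) (p : M)
    (j : 'I_n) (q : M) : 'rV[R]_n :=
  'd (chart_at q \o chart_inv (chart_at p)) (chart_at p q) (delta_mx 0 j).

(* Smoothness on a neighbourhood of p. *)
Definition smooth_fun_at (R : realType) (n : nat) (M : manifold R n)
    (W : normedModType R) (f : M -> W) (p : M) : Prop :=
  smooth_near (f \o chart_inv (chart_at p)) (chart_at p p).

(* The derivative v(f) of f at p, for v in T_pM. *)
Definition deriv (R : realType) (n : nat) (M : manifold R n)
    (W : normedModType R) (f : M -> W) (p : M) (v : 'rV[R]_n) : W :=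
  'd (f \o chart_inv (chart_at p)) (chart_at p p) v.

Definition smooth_map (R : realType) (m n : nat) (M : manifold R m)
    (M' : manifold R n) (f : M -> M') : Prop :=
  forall p, {for p, continuous f} /\
            smooth_fun_at (chart_at (f p) \o f) p.

(* The differential T_pM -> T_{f p}M'. *)
Definition dmap (R : realType) (m n : nat) (M : manifold R m)
    (M' : manifold R n) (f : M -> M') (p : M) (v : 'rV[R]_m) : 'rV[R]_n :=
  deriv (chart_at (f p) \o f) p v.

Definition immersion (R : realType) (m n : nat) (M : manifold R m)
    (M' : manifold R n) (f : M -> M') : Prop :=
  smooth_map f /\ forall p, injective (dmap f p).

Definition smooth_along_at (R : realType) (m n : nat) (M : manifold R m)
    (M' : manifold R n) (f : M -> M') (Z : M -> 'rV[R]_n) (p : M) : Prop :=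
  smooth_fun_at (fun q => vcoord (f p) (f q) (Z q)) p.

Definition smooth_vf_at (R : realType) (n : nat) (M : manifold R n)
    (X : M -> 'rV[R]_n) (p : M) : Prop := smooth_along_at id X p.

(* X \in \Gamma(TM). *)
Definition vector_field (R : realType) (n : nat) (M : manifold R n)
    (X : M -> 'rV[R]_n) : Prop := forall p, smooth_vf_at X p.

(* In coordinates, [X, Y] = dY(X) - dX(Y). *)
Definition lie (R : realType) (n : nat) (M : manifold R n)
    (X Y : M -> 'rV[R]_n) (p : M) : 'rV[R]_n :=
  deriv (fun q => vcoord p q (Y q)) p (X p)
  - deriv (fun q => vcoord p q (X q)) p (Y p).

Record one_form (R : realType) (n : nat) (M : manifold R n) := OneForm {
  one_form_fun :> M -> {linear 'rV[R]_n -> R^o};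
  one_form_smooth : forall X p, smooth_vf_at X p ->
    smooth_fun_at (fun q => one_form_fun q (X q) : R^o) p
}.

Record tensor11 (R : realType) (n : nat) (M : manifold R n) := Tensor11 {
  tensor11_fun :> M -> {linear 'rV[R]_n -> 'rV[R]_n};
  tensor11_smooth : forall X p, smooth_vf_at X p ->
    smooth_vf_at (fun q => tensor11_fun q (X q)) p
}.

Record metric (R : realType) (n : nat) (M : manifold R n) := Metric {
  metric_fun :> M -> 'rV[R]_n -> 'rV[R]_n -> R;
  metric_sym : forall p v w, metric_fun p v w = metric_fun p w v;
  metric_linear : forall p a u v w,
    metric_fun p (a *: u + v) w = a * metric_fun p u w + metric_fun p v w;
  metric_pos : forall p v, v != 0 -> 0 < metric_fun p v v;
  metric_smooth : forall X Y p, smooth_vf_at X p -> smooth_vf_at Y p ->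
    smooth_fun_at (fun q => metric_fun q (X q) (Y q) : R^o) p
}.

(* Affine connections: [conn p v Y] is the covariant derivative at p of the
   field Y, smooth near p, in the direction v of T_pM. *)
Record connection (R : realType) (n : nat) (M : manifold R n) := Connection {
  conn :> M -> 'rV[R]_n -> (M -> 'rV[R]_n) -> 'rV[R]_n;
  conn_linear : forall p Y, smooth_vf_at Y p -> linear (fun v => conn p v Y);
  conn_add : forall p v Y Z, smooth_vf_at Y p -> smooth_vf_at Z p ->
    conn p v (fun q => Y q + Z q) = conn p v Y + conn p v Z;
  conn_leibniz : forall p v (f : M -> R^o) Y,
    smooth_fun_at f p -> smooth_vf_at Y p ->
    conn p v (fun q => f q *: Y q) = deriv f p v *: Y p + f p *: conn p v Y;
  conn_smooth : forall X Y p, smooth_vf_at X p -> smooth_vf_at Y p ->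
    smooth_vf_at (fun q => conn q (X q) Y) p
}.

Definition cov (R : realType) (n : nat) (M : manifold R n)
    (D : connection M) (X Y : M -> 'rV[R]_n) (p : M) : 'rV[R]_n :=
  D p (X p) Y.

Definition torsion_free (R : realType) (n : nat) (M : manifold R n)
    (D : connection M) : Prop :=
  forall X Y p, smooth_vf_at X p -> smooth_vf_at Y p ->
    cov D X Y p - cov D Y X p = lie X Y p.

Definition curvature (R : realType) (n : nat) (M : manifold R n)
    (D : connection M) (X Y Z : M -> 'rV[R]_n) (p : M) : 'rV[R]_n :=
  cov D X (cov D Y Z) p - cov D Y (cov D X Z) p - cov D (lie X Y) Z p.

(* (\nabla_X g)(Y, Z). *)
Definition cov_metric (R : realType) (n : nat) (M : manifold R n)
    (D : connection M) (g : metric M) (X Y Z : M -> 'rV[R]_n) (p : M) : R :=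
  deriv (fun q => g q (Y q) (Z q) : R^o) p (X p)
  - g p (cov D X Y p) (Z p) - g p (Y p) (cov D X Z p).

(* (\nabla_X \kappa)(Y). *)
Definition cov_form (R : realType) (n : nat) (M : manifold R n)
    (D : connection M) (k : one_form M) (X Y : M -> 'rV[R]_n) (p : M) : R :=
  deriv (fun q => k q (Y q) : R^o) p (X p) - k p (cov D X Y p).

(* (d\kappa)(X, Y). *)
Definition dform (R : realType) (n : nat) (M : manifold R n)
    (D : connection M) (k : one_form M) (X Y : M -> 'rV[R]_n) (p : M) : R :=
  cov_form D k X Y p - cov_form D k Y X p.

(* The connection induced by D on the fields along f : M -> M'. Writing
   Z = \sum_j Z^j (E_j \o f) near p, with E_j the coordinate fields of the
   chart at f p, it is \sum_j (v(Z^j) E_j + Z^j \nabla_{df v} E_j). This is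
   \nabla_X Y for X tangent to M and Y a field of M' defined only along M. *)
Definition cov_along (R : realType) (m n : nat) (M : manifold R m)
    (M' : manifold R n) (D : connection M') (f : M -> M') (X : M -> 'rV[R]_m)
    (Z : M -> 'rV[R]_n) (p : M) : 'rV[R]_n :=
  deriv (fun q => vcoord (f p) (f q) (Z q)) p (X p)
  + \sum_(j < n) Z p 0 j *: D (f p) (dmap f p (X p)) (coord_field (f p) j).

Definition statistical (R : realType) (n : nat) (M : manifold R n)
    (g : metric M) (D : connection M) : Prop :=
  torsion_free D /\
  forall X Y Z p, smooth_vf_at X p -> smooth_vf_at Y p -> smooth_vf_at Z p ->
    cov_metric D g X Y Z p = cov_metric D g Y X Z p /\
    cov_metric D g X Y Z p = cov_metric D g X Z Y p.

Definition dual_connection (R : realType) (n : nat) (M : manifold R n)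
    (g : metric M) (D Ds : connection M) : Prop :=
  forall X Y Z p, smooth_vf_at X p -> smooth_vf_at Y p -> smooth_vf_at Z p ->
    deriv (fun q => g q (X q) (Y q) : R^o) p (Z p) =
    g p (X p) (cov Ds Z Y p) + g p (cov D Z X p) (Y p).

(* F^2 = I and \nabla F = 0. *)
Definition locally_product_like (R : realType) (n : nat) (M : manifold R n)
    (g : metric M) (D : connection M) (F : tensor11 M) : Prop :=
  [/\ statistical g D,
      forall p v, F p (F p v) = v &
      forall X Y p, smooth_vf_at X p -> smooth_vf_at Y p ->
        cov D X (fun q => F q (Y q)) p - F p (cov D X Y p) = 0].

Definition adjoint_tensor (R : realType) (n : nat) (M : manifold R n)
    (g : metric M) (F Fs : tensor11 M) : Prop :=
  forall p v w, g p (F p v) w = g p v (Fs p w).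

Definition induced_metric (R : realType) (m n : nat) (M : manifold R m)
    (M' : manifold R n) (f : M -> M') (g : metric M') (p : M)
    (v w : 'rV[R]_m) : R :=
  g (f p) (dmap f p v) (dmap f p w).

Definition unit_normal (R : realType) (n : nat) (M : manifold R n)
    (M' : manifold R n.+1) (f : M -> M') (g : metric M')
    (N : M -> 'rV[R]_n.+1) : Prop :=
  [/\ forall p, smooth_along_at f N p,
      forall p, g (f p) (N p) (N p) = 1 &
      forall p v, g (f p) (N p) (dmap f p v) = 0].

(* The 1-form k and the pair (A, As) are stated for the connection D' of the
   ambient manifold; the formulas for its dual connection are those with
   (As, A) and the opposite of k. *)
Definition gauss_weingarten (R : realType) (n : nat) (M : manifold R n)
    (M' : manifold R n.+1) (f : M -> M') (g : metric M')
    (N : M -> 'rV[R]_n.+1) (D' : connection M') (D : connection M)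
    (A As : tensor11 M) (k : M -> 'rV[R]_n -> R) : Prop :=
  (forall X Y p, vector_field X -> vector_field Y ->
     cov_along D' f X (fun q => dmap f q (Y q)) p =
     dmap f p (cov D X Y p)
     + induced_metric f g p (As p (X p)) (Y p) *: N p) /\
  (forall X p, vector_field X ->
     cov_along D' f X N p = - dmap f p (A p (X p)) + k p (X p) *: N p).

(* (\overline\nabla_X A)_N Y, again with the opposite of k for the dual one. *)
Definition cov_shape (R : realType) (n : nat) (M : manifold R n)
    (D : connection M) (A : tensor11 M) (k : M -> 'rV[R]_n -> R)
    (X Y : M -> 'rV[R]_n) (p : M) : 'rV[R]_n :=
  cov D X (fun q => A q (Y q)) p - k p (X p) *: A p (Y p)
  - A p (cov D X Y p).

Definition commutator (R : realType) (n : nat) (M : manifold R n)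
    (A B : tensor11 M) (p : M) (v : 'rV[R]_n) : 'rV[R]_n :=
  A p (B p v) - B p (A p v).

(* Main.v *)
Require Import Defs.
From HB Require Import structures.
From mathcomp Require Import all_boot all_order all_algebra.
From mathcomp Require Import all_classical all_reals all_analysis.
Import Order.TTheory GRing.Theory Num.Theory numFieldNormedType.Exports.
From mathcomp Require Import ring.
Local Open Scope ring_scope.

(* Since F is parallel, so is F along the immersion: differentiating F N = xi
   gives nabla_X xi = - phi (A X) + kappa(X) xi, and differentiating the
   decomposition of F Y gives
   nabla_X (phi Y) = phi (nabla_X Y) + eta^*(Y) A X + g(A^* X, Y) xi.
   Inserting both in R(X, Y) xi yields the first formula, once one knows that
   nabla is torsion free and that A and A^* are self-adjoint; these follow from
   the Gauss formulas, the ambient connections being torsion free (which rests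
   on the symmetry of second differentials). The statistical hypothesis makes
   the dual connection torsion free and F^* parallel for it, so the second
   formula is the first one for the dual data, with -kappa for kappa. *)

Set Implicit Arguments.
Unset Strict Implicit.

(** * Second differentials *)

Section Differentials.
Context (R : realType).
Implicit Types V W : normedModType R.

(** The first-order expansion of [f] at [x] only sees values near [x], so it holds for [g] too;
    uniqueness of the differential then identifies ['d g x]. *)
Lemma near_eq_is_diff V W (f g df : V -> W) (x : V) :
  {near x, f =1 g} -> is_diff x f df -> is_diff x g df.
Proof.
move=> fg [fx fdf].
have gE : g \o shift x = cst (g x) + 'd f x +o_ 0 id.
  apply/eqaddoP => _/posnumP[e].
  have /eqaddoP/(_ e%:num (gt0 e)) := diff_locally fx.
  have fg0 : \forall y \near (0 : V), f (y + x) = g (y + x).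
    have : \near x, f x = g x by [].
    rewrite (near_shift 0 x (fun y => f y = g y)).
    by apply: filterS => y /=; rewrite subr0.
  rewrite (nbhs_singleton fg).
  apply: filterS2 fg0 => y /= fgy.
  by rewrite /shift /= /cst !fctE /= fgy.
have dc := diff_continuous fx.
have dgE := diff_unique dc gE.
split; last by rewrite dgE.
by apply/diff_locallyP; rewrite dgE.
Qed.

Lemma near_eq_differentiable V W (f g : V -> W) (x : V) :
  {near x, f =1 g} -> differentiable f x -> differentiable g x.
Proof. by move=> fg fx; case: (near_eq_is_diff fg (differentiableP fx)). Qed.

Lemma near_eq_diff V W (f g : V -> W) (x : V) :
  {near x, f =1 g} -> differentiable f x -> 'd f x = 'd g x :> (V -> W).
Proof.
move=> fg fx; have [_ E] := near_eq_is_diff fg (differentiableP fx).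
exact: esym E.
Qed.

Lemma is_diff_scale V W (h dh : V -> R^o) (f df : V -> W) (x : V) :
  is_diff x h dh -> is_diff x f df ->
  is_diff x (fun y => h y *: f y) (fun v => h x *: df v + dh v *: f x).
Proof.
move=> hx fx.
(* Scaling is packaged as a continuous bilinear map, which makes the product rule an instance of the
   chain rule. *)
have sb : bilinear_for *:%R *:%R (fun (a : R^o) (u : W) => a *: u).
  split=> u a b c /=; first by rewrite scalerDl scalerA.
  by rewrite scalerDr !scalerA mulrC.
pose sM := @bilinear_isBilinear.Build R R^o W W _ _ _ sb.
pose s : {bilinear R^o -> W -> W} := HB.pack (fun (a : R^o) (u : W) => a *: u) sM.
have sc : continuous (fun p : R^o * W => s p.1 p.2).
  by move=> p; exact: scale_continuous.
have sx : is_diff (h x, f x) (fun p : R^o * W => s p.1 p.2)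
    (fun q => h x *: q.2 + q.1 *: f x).
  split; first exact: differentiable_bilin.
  by rewrite diff_bilin.
have := @is_diff_comp R V _ W (fun y => (h y, f y)) _
  (fun p : R^o * W => s p.1 p.2) _ x _ sx.
by apply.
Qed.

Lemma is_derive_line V (f : V -> R^o) (a v : V) (s : R) :
  differentiable f (a + s *: v) ->
  is_derive s (1 : R) (fun t : R => f (a + t *: v)) ('d f (a + s *: v) v).
Proof.
move=> fs.
have ls : is_diff s (fun t : R => a + t *: v) (fun t : R => t *: v).
  have := @is_diffD R R V (cst a) ( *:%R^~ v) _ _ s
    (is_diff_cst a s) (is_diff_scalel s v).
  by rewrite add0r.
have cs := @is_diff_comp R R V R^o _ _ f _ s ls (differentiableP fs).
apply: DeriveDef; first by apply: diff_derivable; case: cs.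
rewrite deriveE; last by case: cs.
by rewrite diff_val /= scale1r.
Qed.

(** The mean value theorem is used twice: along [v] for the difference of [f] on two opposite sides
    of the parallelogram, then along [w] for the derivative so obtained. *)
Lemma second_difference V (f : V -> R^o) (x v w : V) (h : R) : 0 < h ->
  (forall s t, 0 <= s <= h -> 0 <= t <= h ->
    differentiable f (x + s *: v + t *: w) /\
    differentiable (fun y => 'd f y v : R^o) (x + s *: v + t *: w)) ->
  exists c d, [/\ 0 <= c <= h, 0 <= d <= h &
    f (x + h *: v + h *: w) - f (x + h *: v) - (f (x + h *: w) - f x) =
    'd (fun y => 'd f y v : R^o) (x + c *: v + d *: w) w * h * h].
Proof.
move=> h0 hd.
have h00 : (0 : R) <= 0 <= h by rewrite lexx ltW.
have hh : 0 <= h <= h by rewrite lexx ltW.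
pose F (s : R) := f (x + h *: w + s *: v) - f (x + s *: v).
have dF s : s \in `[0, h] -> is_derive s (1 : R) F
    ('d f (x + h *: w + s *: v) v - 'd f (x + s *: v) v).
  rewrite in_itv /= => sI; apply: is_deriveB.
    by apply: is_derive_line; rewrite addrAC; exact: (hd s h sI hh).1.
  by apply: is_derive_line; have [] := hd s 0 sI h00; rewrite scale0r addr0.
have [c cI] := @MVT_segment R F _ 0 h (ltW h0)
  (fun s sI => dF s (subset_itv_oo_cc sI))
  (derivable_within_continuous (fun s sI => @ex_derive _ _ _ _ _ _ _ (dF s sI))).
rewrite subr0 /F !scale0r !addr0 => Fc.
have cI' : 0 <= c <= h by move: cI; rewrite in_itv.
pose G (t : R) := 'd f (x + c *: v + t *: w) v.
have dG t : t \in `[0, h] -> is_derive t (1 : R) G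
    ('d (fun y => 'd f y v : R^o) (x + c *: v + t *: w) w).
  rewrite in_itv /= => tI.
  exact: (is_derive_line (hd c t cI' tI).2).
have [d dI] := @MVT_segment R G _ 0 h (ltW h0)
  (fun s sI => dG s (subset_itv_oo_cc sI))
  (derivable_within_continuous (fun s sI => @ex_derive _ _ _ _ _ _ _ (dG s sI))).
rewrite subr0 /G scale0r addr0 => Gd.
move: Fc; rewrite (addrAC x (h *: w) (c *: v)) Gd => Fc.
exists c, d; split=> //.
by rewrite (addrAC x (h *: v)).
Qed.


(** Schwarz's theorem. The second difference is symmetric in [v] and [w], so by [second_difference]
    the two mixed derivatives agree at two points as close to [x] as desired; their continuity at
    [x] concludes. *)
Lemma second_diff_sym_scalar V (f : V -> R^o) (U : set V) (x v w : V) :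
  open U -> U x -> Ck_on 2 U f ->
  'd (fun y => 'd f y v : R^o) x w = 'd (fun y => 'd f y w : R^o) x v.
Proof.
move=> Uo Ux [fd /= d2f].
have cont a b : {for x, continuous (fun y => 'd (fun z => 'd f z a : R^o) y b : R^o)}.
  by have [_ /(_ b)/(_ x Ux)] := d2f a.
apply/eqP/negPn/negP => ne.
(* Half of the supposed gap: two errors below [e] cannot add up to it. *)
pose e := `|'d (fun y => 'd f y v : R^o) x w - 'd (fun y => 'd f y w : R^o) x v| / 2.
have e0 : 0 < e by rewrite divr_gt0// normr_gt0 subr_eq0.
have near_c a b : \forall y \near x,
    `|'d (fun z => 'd f z a : R^o) x b - 'd (fun z => 'd f z a : R^o) y b| < e.
  by have /cvgrPdist_lt/(_ e e0) := cont a b.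
have [r /= r0 xr] : exists2 r : R, 0 < r & forall y, `|y - x| < r -> [/\ U y,
    `|'d (fun z => 'd f z v : R^o) x w - 'd (fun z => 'd f z v : R^o) y w| < e &
    `|'d (fun z => 'd f z w : R^o) x v - 'd (fun z => 'd f z w : R^o) y v| < e].
    have : \forall y \near x, [/\ U y,
    `|'d (fun z => 'd f z v : R^o) x w - 'd (fun z => 'd f z v : R^o) y w| < e &
    `|'d (fun z => 'd f z w : R^o) x v - 'd (fun z => 'd f z w : R^o) y v| < e].
    have Ux' : \forall y \near x, U y by exact: open_nbhs_nbhs.
    by apply: filterS3 Ux' (near_c v w) (near_c w v).
  move=> /nbhs_normP[r /= r0 xr].
  by exists r => // y yr; apply: xr; rewrite /ball_ /= distrC.
(* With this step the parallelogram spanned by [h *: v] and [h *: w] at [x] stays in the ball of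
   radius [r]; the summand 1 keeps the denominator positive. *)
pose h := r / (`|v| + `|w| + 1) / 2.
have d0 : 0 < `|v| + `|w| + 1 by rewrite ltr_wpDl// addr_ge0.
have h0 : 0 < h by rewrite /h !divr_gt0.
have inr s t : 0 <= s <= h -> 0 <= t <= h ->
    `|x + s *: v + t *: w - x| < r.
  move=> /andP[s0 sh] /andP[t0 th].
  rewrite addrAC [x + _]addrC addrK (le_lt_trans (ler_normD _ _))//.
  rewrite !normrZ !ger0_norm//.
  have : s * `|v| + t * `|w| <= h * (`|v| + `|w| + 1).
    rewrite -addrA [leRHS]mulrDr lerD// ?ler_wpM2r//.
    by rewrite (le_trans (ler_wpM2r _ th))// ler_wpM2l ?lerDl// ltW.
  move=> /le_lt_trans; apply.
  by rewrite /h mulrAC divfK ?gt_eqF// ltr_pdivrMr// mulr_natr mulr2n ltrDl.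
have [c [d [cI dI E1]]] : exists c d, [/\ 0 <= c <= h, 0 <= d <= h &
    f (x + h *: v + h *: w) - f (x + h *: v) - (f (x + h *: w) - f x) =
    'd (fun y => 'd f y v : R^o) (x + c *: v + d *: w) w * h * h].
  apply: second_difference => // s t sI tI.
  have [Us _ _] := xr _ (inr s t sI tI).
  by split; [exact: fd | exact: (d2f v).1].
have [d' [c' [dI' cI' E2]]] : exists c d, [/\ 0 <= c <= h, 0 <= d <= h &
    f (x + h *: w + h *: v) - f (x + h *: w) - (f (x + h *: v) - f x) =
    'd (fun y => 'd f y w : R^o) (x + c *: w + d *: v) v * h * h].
  apply: second_difference => // s t sI tI.
  have := inr t s tI sI; rewrite (addrAC x) => /xr[Us _ _].
  by split; [exact: fd | exact: (d2f w).1].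
have {E1 E2} E : 'd (fun y => 'd f y v : R^o) (x + c *: v + d *: w) w =
    'd (fun y => 'd f y w : R^o) (x + c' *: v + d' *: w) v.
  apply: (@mulIf _ h); first by rewrite gt_eqF.
  apply: (@mulIf _ h); first by rewrite gt_eqF.
  rewrite -E1 (addrAC x (c' *: v)) -E2 (addrAC x (h *: v)).
  by rewrite !opprB !addrA [LHS]addrAC [RHS]addrAC [in LHS](addrAC (f _)).
have [_ n1 _] := xr _ (inr c d cI dI).
have [_ _ n2] := xr _ (inr c' d' cI' dI').
rewrite E in n1; rewrite distrC in n2.
have := le_lt_trans (ler_distD _ _ _) (ltrD n1 n2).
by rewrite /e -splitr ltxx.
Qed.

End Differentials.

(** * Smooth functions on normed modules *)

Section RowCoordinates.
Context (R : realType) (m : nat).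

(** Coordinates take values in [R^o] so that they are linear maps between normed modules, to which
    the differential calculus applies. *)
Definition row_coord (j : 'I_m) (v : 'rV[R]_m) : R^o := v 0 j.

Lemma row_coord_linear j : linear (row_coord j).
Proof. by move=> a u v; rewrite /row_coord !mxE. Qed.

HB.instance Definition _ j :=
  GRing.isLinear.Build R 'rV[R]_m R^o _ (row_coord j) (row_coord_linear j).

Lemma row_coord_continuous j : continuous (row_coord j).
Proof. exact: coord_continuous. Qed.

Lemma linear_row_sum (W : lmodType R) (L : {linear 'rV[R]_m -> W}) v :
  L v = \sum_j row_coord j v *: L (delta_mx 0 j).
Proof.
by rewrite {1}(row_sum_delta v) linear_sum; apply: eq_bigr => j _; rewrite linearZ.
Qed.

End RowCoordinates.

Section SmoothFunctions.
Context (R : realType).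
Implicit Types V W : normedModType R.

Lemma is_diff_lin V W W' (L : {linear W -> W'}) (f df : V -> W) (x : V) :
  continuous L -> is_diff x f df ->
  is_diff x (fun y => L (f y)) (fun v => L (df v)).
Proof.
move=> Lc fx.
have Lx : is_diff (f x) L L.
  by split; [exact: linear_differentiable | exact: diff_lin].
exact: (@is_diff_comp R V W W' f df L L x fx Lx).
Qed.

Lemma is_diff_bigsum V W m (f df : 'I_m -> V -> W) (x : V) :
  (forall i, is_diff x (f i) (df i)) ->
  is_diff x (fun y => \sum_i f i y) (fun v => \sum_i df i v).
Proof.
move=> fx; elim: m f df fx => [|m IH] f df fx.
  have -> : (fun y => \sum_(i < 0) f i y) = cst 0.
    by apply/funext => y; rewrite big_ord0.
  have -> : (fun y => \sum_(i < 0) df i y) = 0.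
    by apply/funext => y; rewrite big_ord0.
  exact: is_diff_cst.
have -> : (fun y => \sum_(i < m.+1) f i y) =
    f ord0 + (fun y => \sum_(i < m) f (lift ord0 i) y).
  by apply/funext => y; rewrite big_ord_recl.
have -> : (fun y => \sum_(i < m.+1) df i y) =
    df ord0 + (fun y => \sum_(i < m) df (lift ord0 i) y).
  by apply/funext => y; rewrite big_ord_recl.
by apply: is_diffD => //; exact: IH.
Qed.

(** Since [U] is open, equality on [U] is equality near each of its points, so it passes to the
    differentials and the induction goes through. *)
Lemma Ck_on_ext V W k (U : set V) (f g : V -> W) :
  open U -> (forall x, U x -> f x = g x) -> Ck_on k U f -> Ck_on k U g.
Proof.
move=> Uo; elim: k f g => [|k IH] f g fg /=.
  move=> fc x Ux; rewrite /prop_for /continuous_at -fg//.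
  apply: cvg_trans (fc x Ux); apply: near_eq_cvg.
  by apply: filterS (open_nbhs_nbhs (conj Uo Ux)) => y /fg.
have nfg x : U x -> {near x, f =1 g}.
  by move=> Ux; apply: filterS (open_nbhs_nbhs (conj Uo Ux)) => y /fg.
move=> [fd dfk]; split=> [x Ux|v].
  exact: near_eq_differentiable (nfg x Ux) (fd x Ux).
apply: IH (dfk v) => x Ux.
by rewrite (near_eq_diff (nfg x Ux) (fd x Ux)).
Qed.

Lemma Ck_on_subset V W k (U U' : set V) (f : V -> W) :
  (U' `<=` U)%classic -> Ck_on k U f -> Ck_on k U' f.
Proof.
move=> UU; elim: k f => [|k IH] f /=; first by move=> fc x /UU; exact: fc.
by move=> [fd dfk]; split=> [x /UU|v]; [exact: fd | exact: IH].
Qed.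

Lemma Ck_onW V W k (U : set V) (f : V -> W) : Ck_on k.+1 U f -> Ck_on k U f.
Proof.
elim: k f => [|k IH] f [fd dfk].
  by move=> x /fd; exact: differentiable_continuous.
by split=> // v; apply: IH; exact: dfk.
Qed.

Lemma Ck_on_cst V W k (U : set V) (w : W) : Ck_on k U (fun _ : V => w).
Proof.
elim: k w => [|k IH] w /=; first by move=> x _; exact: cst_continuous.
split=> [x _|v]; first exact: differentiable_cst.
have -> : (fun x : V => 'd (fun _ : V => w) x v) = (fun=> 0).
  by apply/funext => x; rewrite (diff_cst w x).
exact: IH.
Qed.

Lemma Ck_on_add V W k (U : set V) (f g : V -> W) : open U ->
  Ck_on k U f -> Ck_on k U g -> Ck_on k U (fun x => f x + g x).
Proof.
move=> Uo; elim: k f g => [|k IH] f g /=.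
  by move=> fc gc x Ux; apply: continuousD; [exact: fc | exact: gc].
move=> [fd df] [gd dg].
have sx x : U x -> is_diff x (fun y => f y + g y)
      (fun v => 'd f x v + 'd g x v).
  by move=> Ux; apply: is_diffD; apply: differentiableP; [exact: fd | exact: gd].
split=> [x /sx[]//|v].
apply: (@Ck_on_ext _ _ _ _ (fun x => 'd f x v + 'd g x v)) => //.
  by move=> x /sx[_ E]; exact: esym (congr1 (fun d : V -> W => d v) E).
exact: IH (df v) (dg v).
Qed.

Lemma Ck_on_scale V W k (U : set V) (h : V -> R^o) (f : V -> W) : open U ->
  Ck_on k U h -> Ck_on k U f -> Ck_on k U (fun x => h x *: f x).
Proof.
move=> Uo; elim: k h f => [|k IH] h f.
  by move=> /= hc fc x Ux; apply: continuousZ; [exact: hc | exact: fc].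
move=> hk fk; have [[hd dh] [fd df]] := (hk, fk).
have sx x : U x -> is_diff x (fun y => h y *: f y)
    (fun v => h x *: 'd f x v + 'd h x v *: f x).
  by move=> Ux; apply: is_diff_scale; apply: differentiableP; [exact: hd | exact: fd].
split=> [x /sx[]//|v].
apply: (@Ck_on_ext _ _ _ _ (fun x => h x *: 'd f x v + 'd h x v *: f x)) => //.
  by move=> x /sx[_ ->].
(* Each product pairs a derivative, of class [k], with an undifferentiated factor, whose class
   [k.+1] must first be lowered to [k]. *)
apply: (Ck_on_add Uo); first exact: IH (Ck_onW hk) (df v).
exact: IH (dh v) (Ck_onW fk).
Qed.

Lemma Ck_on_lin V W W' k (U : set V) (L : {linear W -> W'}) (f : V -> W) :
  open U -> continuous L -> Ck_on k U f -> Ck_on k U (fun x => L (f x)).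
Proof.
move=> Uo Lc; elim: k f => [|k IH] f /=.
  by move=> fc x Ux; apply: continuous_comp; [exact: fc | exact: Lc].
move=> [fd df].
have Lx x : U x -> is_diff x (fun y => L (f y)) (fun v => L ('d f x v)).
  by move=> Ux; apply: is_diff_lin => //; apply: differentiableP; exact: fd.
split=> [x /Lx[]//|v].
by apply: Ck_on_ext (IH _ (df v)) => // x /Lx[_ ->].
Qed.

(** Coordinates are continuous and linear, hence commute with both differentiations; this reduces
    the claim to the scalar case. *)
Lemma second_diff_sym V m (f : V -> 'rV[R]_m) (U : set V) (x v w : V) :
  open U -> U x -> Ck_on 2 U f ->
  'd (fun y => 'd f y v) x w = 'd (fun y => 'd f y w) x v.
Proof.
move=> Uo Ux fk; apply/rowP => j.
have fkj := Ck_on_lin Uo (@row_coord_continuous R m j) fk.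
have := second_diff_sym_scalar v w Uo Ux fkj.
have [fd df] := fk.
suff coordE a b : 'd (fun y => 'd (fun x => row_coord j (f x)) y a : R^o) x b =
    row_coord j ('d (fun y => 'd f y a) x b) by rewrite (coordE v w) (coordE w v).
have dj y : U y -> is_diff y (fun y => row_coord j (f y))
    (fun v => row_coord j ('d f y v)).
  move=> Uy; apply: is_diff_lin; first exact: row_coord_continuous.
  by apply: differentiableP; exact: fd.
have ddj : is_diff x (fun y => row_coord j ('d f y a))
    (fun b => row_coord j ('d (fun y => 'd f y a) x b)).
  apply: is_diff_lin; first exact: row_coord_continuous.
  by apply: differentiableP; exact: (df a).1.
suff : is_diff x (fun y => 'd (fun x => row_coord j (f x)) y a : R^o)
    (fun b => row_coord j ('d (fun y => 'd f y a) x b)) by case=> _ ->.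
apply: near_eq_is_diff ddj.
by apply: filterS (open_nbhs_nbhs (conj Uo Ux)) => y /dj[_ ->].
Qed.

(** Base point and vector vary together. Expanding [h y] in the standard basis leaves finitely many
    products of a scalar function with a directional derivative of [f], so the product rule
    suffices. *)
Lemma is_diff_diff_apply m W (f : 'rV[R]_m -> W) (h dh : 'rV[R]_m -> 'rV[R]_m)
    (x : 'rV[R]_m) :
  differentiable f x ->
  (forall v, differentiable (fun y => 'd f y v) x) ->
  is_diff x h dh ->
  is_diff x (fun y => 'd f y (h y))
    (fun u => 'd (fun y => 'd f y (h x)) x u + 'd f x (dh u)).
Proof.
move=> fd df hd.
have -> : (fun y => 'd f y (h y)) =
    (fun y => \sum_j row_coord j (h y) *: 'd f y (delta_mx 0 j)).
  by apply/funext => y; rewrite linear_row_sum.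
have -> : (fun u => 'd (fun y => 'd f y (h x)) x u + 'd f x (dh u)) =
   (fun u => \sum_j (row_coord j (h x) *: 'd (fun y => 'd f y (delta_mx 0 j)) x u +
                     row_coord j (dh u) *: 'd f x (delta_mx 0 j))).
  apply/funext => u; rewrite big_split /= -linear_row_sum; congr (_ + _).
  have : is_diff x (fun y => \sum_j row_coord j (h x) *: 'd f y (delta_mx 0 j))
      (fun u => \sum_j row_coord j (h x) *: 'd (fun y => 'd f y (delta_mx 0 j)) x u).
    apply: is_diff_bigsum => j.
    have := @is_diffZ _ _ _ _ _ (row_coord j (h x)) _ (differentiableP (df (delta_mx 0 j))).
    by [].
  case=> _ /(congr1 (fun d => d u)) /= <-; congr ('d _ x u).
  by apply/funext => y; rewrite linear_row_sum.
apply: is_diff_bigsum => j; apply: is_diff_scale.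
  by apply: is_diff_lin => //; exact: row_coord_continuous.
exact: differentiableP.
Qed.

Lemma smooth_near_ext V W (f g : V -> W) (x : V) :
  {near x, f =1 g} -> smooth_near f x -> smooth_near g x.
Proof.
move=> fg [U [Uo Ux fs]].
have [B [[Bo Bx] Bfg]] : exists B, open_nbhs x B /\ (B `<=` [set y | f y = g y])%classic.
  by move: fg; rewrite /prop_near1 /= nbhsE => -[B ? ?]; exists B.
exists (U `&` B)%classic; split=> //; first exact: openI.
move=> k; apply: (@Ck_on_ext _ _ _ _ f); first exact: openI.
  by move=> y [_ /Bfg].
by apply: Ck_on_subset (fs k) => y [].
Qed.

Lemma smooth_near_cst V W (w : W) (x : V) : smooth_near (fun _ : V => w) x.
Proof.
exists setT; split=> //; first exact: openT.
by move=> k; exact: Ck_on_cst.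
Qed.

Lemma smooth_near_add V W (f g : V -> W) (x : V) :
  smooth_near f x -> smooth_near g x -> smooth_near (fun y => f y + g y) x.
Proof.
move=> [U [Uo Ux fs]] [U' [Uo' Ux' gs]].
exists (U `&` U')%classic; split=> //; first exact: openI.
move=> k; apply: Ck_on_add; first exact: openI.
  by apply: Ck_on_subset (fs k) => y [].
by apply: Ck_on_subset (gs k) => y [].
Qed.

Lemma smooth_near_scale V W (h : V -> R^o) (f : V -> W) (x : V) :
  smooth_near h x -> smooth_near f x -> smooth_near (fun y => h y *: f y) x.
Proof.
move=> [U [Uo Ux fs]] [U' [Uo' Ux' gs]].
exists (U `&` U')%classic; split=> //; first exact: openI.
move=> k; apply: Ck_on_scale; first exact: openI.
  by apply: Ck_on_subset (fs k) => y [].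
by apply: Ck_on_subset (gs k) => y [].
Qed.

Lemma smooth_near_lin V W W' (L : {linear W -> W'}) (f : V -> W) (x : V) :
  continuous L -> smooth_near f x -> smooth_near (fun y => L (f y)) x.
Proof.
move=> Lc [U [Uo Ux fs]]; exists U; split=> // k; exact: Ck_on_lin.
Qed.

Lemma smooth_near_differentiable V W (f : V -> W) (x : V) :
  smooth_near f x -> differentiable f x.
Proof. by move=> [U [_ Ux /(_ 1)[/(_ x Ux)]]]. Qed.

End SmoothFunctions.

(** * Charts and connections *)

Section ChartCalculus.
Context (R : realType) (n : nat) (M : manifold R n).
Implicit Types (a b c p q : M) (W : normedModType R).

(** Transfers germs on the manifold to germs in coordinates, by continuity of the inverse chart. *)
Lemma near_chart_inv a q (P : M -> Prop) : chart_dom (chart_at a) q ->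
  (\forall x \near q, P x) ->
  \forall y \near chart_at a q, P (chart_inv (chart_at a) y).
Proof.
move=> aq Pq.
have := @chart_inv_cont _ _ _ (chart_at a) (chart_at a q) (imageP _ aq).
by move=> /(_ P); apply; rewrite chart_mapK.
Qed.

Lemma near_chart_dom a q : chart_dom (chart_at a) q ->
  \forall x \near q, chart_dom (chart_at a) x.
Proof. by move=> aq; apply: open_nbhs_nbhs; split=> //; exact: chart_dom_open. Qed.

Lemma near_chart_invK a q : chart_dom (chart_at a) q ->
  \forall y \near chart_at a q, chart_at a (chart_inv (chart_at a) y) = y.
Proof.
move=> aq.
have : \forall y \near chart_at a q, (chart_at a @` chart_dom (chart_at a))%classic y.
  apply: open_nbhs_nbhs; split; first exact: chart_img_open.
  by exists q.
by apply: filterS => _ [x ax <-]; rewrite chart_mapK.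
Qed.

(* [jac a b q] is the differential at q of the change of charts from
   [chart_at a] to [chart_at b]; thus [vcoord b q = jac q b q] and
   [coord_field b j q = jac b q q (delta_mx 0 j)]. *)
Definition jac a b q : {linear 'rV[R]_n -> 'rV[R]_n} :=
  'd (chart_at b \o chart_inv (chart_at a)) (chart_at a q).

Lemma transition_differentiable a b q :
  chart_dom (chart_at a) q -> chart_dom (chart_at b) q ->
  differentiable (chart_at b \o chart_inv (chart_at a)) (chart_at a q).
Proof.
move=> aq bq; have [] := chart_at_compat a b 1.
by move=> h _; apply: h; exists q.
Qed.

(** The chain rule for the transition map. Inserting the chart at [b] and its inverse changes
    nothing only where that chart is defined, hence the passage through germs. *)
Lemma is_diff_change_chart W (h : M -> W) a b q dh :
  chart_dom (chart_at a) q -> chart_dom (chart_at b) q ->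
  is_diff (chart_at b q) (h \o chart_inv (chart_at b)) dh ->
  is_diff (chart_at a q) (h \o chart_inv (chart_at a)) (fun v => dh (jac a b q v)).
Proof.
move=> aq bq hb.
have tb := differentiableP (transition_differentiable aq bq).
have : is_diff (chart_at a q) ((h \o chart_inv (chart_at b)) \o
    (chart_at b \o chart_inv (chart_at a))) (fun v => dh (jac a b q v)).
  apply: (@is_diff_comp R _ _ W _ _ _ _ _ tb).
  by rewrite /= chart_mapK.
apply: near_eq_is_diff.
have := near_chart_inv aq (near_chart_dom bq).
by apply: filterS => y by_ /=; rewrite chart_mapK.
Qed.

Lemma jacK a q v : chart_dom (chart_at a) q -> jac a a q v = v.
Proof.
move=> aq; have : is_diff (chart_at a q) (chart_at a \o chart_inv (chart_at a)) id.
  apply: near_eq_is_diff (is_diff_id (chart_at a q)).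
  by apply: filterS (near_chart_invK aq) => y /= ->.
by move=> [_ E]; exact: (congr1 (fun d : _ -> _ => d v) E).
Qed.

(** The cocycle rule: [is_diff_change_chart] with the chart at [c] as the function. *)
Lemma jac_comp a b c q v :
  chart_dom (chart_at a) q -> chart_dom (chart_at b) q ->
  chart_dom (chart_at c) q -> jac b c q (jac a b q v) = jac a c q v.
Proof.
move=> aq bq cq.
have [_ E] := is_diff_change_chart aq bq
  (differentiableP (transition_differentiable bq cq)).
exact: (esym (congr1 (fun d : _ -> _ => d v) E)).
Qed.

Lemma vcoordE a q v : vcoord a q v = jac q a q v.
Proof. by []. Qed.

Lemma vcoord_id a v : vcoord a a v = v.
Proof. by rewrite vcoordE jacK//; exact: chart_at_dom. Qed.

Lemma vcoord_jac a q v : chart_dom (chart_at a) q -> vcoord a q (jac a q q v) = v.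
Proof. by move=> aq; rewrite vcoordE jac_comp ?jacK//; exact: chart_at_dom. Qed.

Lemma jac_vcoord a q v : chart_dom (chart_at a) q -> jac a q q (vcoord a q v) = v.
Proof. by move=> aq; rewrite vcoordE jac_comp ?jacK//; exact: chart_at_dom. Qed.

Definition is_deriv W (h : M -> W) p (dh : 'rV[R]_n -> W) :=
  is_diff (chart_at p p) (h \o chart_inv (chart_at p)) dh.

Lemma is_deriv_val W (h : M -> W) p dh v : is_deriv h p dh -> Defs.deriv h p v = dh v.
Proof. by case=> _ E; rewrite /Defs.deriv E. Qed.

Lemma smooth_is_deriv W (h : M -> W) p :
  smooth_fun_at h p -> is_deriv h p (Defs.deriv h p).
Proof. by move=> /smooth_near_differentiable /differentiableP. Qed.

Lemma is_deriv_ext W (h k : M -> W) p dh :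
  (\forall q \near p, h q = k q) -> is_deriv h p dh -> is_deriv k p dh.
Proof.
move=> hk; apply: near_eq_is_diff.
exact: (near_chart_inv (chart_at_dom p) hk).
Qed.

Lemma is_deriv_add W (h k : M -> W) p dh dk :
  is_deriv h p dh -> is_deriv k p dk ->
  is_deriv (fun q => h q + k q) p (fun v => dh v + dk v).
Proof. exact: is_diffD. Qed.

Lemma is_deriv_scale W (h : M -> R^o) (k : M -> W) p dh dk :
  is_deriv h p dh -> is_deriv k p dk ->
  is_deriv (fun q => h q *: k q) p (fun v => h p *: dk v + dh v *: k p).
Proof.
move=> hp kp; have := is_diff_scale hp kp.
by rewrite /= !chart_mapK//; exact: chart_at_dom.
Qed.

Lemma is_deriv_lin W W' (L : {linear W -> W'}) (h : M -> W) p dh :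
  continuous L -> is_deriv h p dh ->
  is_deriv (fun q => L (h q)) p (fun v => L (dh v)).
Proof. exact: is_diff_lin. Qed.

Lemma is_deriv_sum W m (h dh : 'I_m -> _) p :
  (forall j, @is_deriv W (h j) p (dh j)) ->
  is_deriv (fun q => \sum_j h j q) p (fun v => \sum_j dh j v).
Proof. by move=> hp; exact: is_diff_bigsum. Qed.

Lemma is_deriv_cst W (w : W) p : is_deriv (fun=> w) p (fun=> 0).
Proof. exact: is_diff_cst. Qed.

Lemma smooth_fun_ext W (h k : M -> W) p :
  (\forall q \near p, h q = k q) -> smooth_fun_at h p -> smooth_fun_at k p.
Proof.
move=> hk; apply: smooth_near_ext.
exact: (near_chart_inv (chart_at_dom p) hk).
Qed.

Lemma smooth_fun_cst W (w : W) p : smooth_fun_at (fun _ : M => w) p.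
Proof. exact: smooth_near_cst. Qed.

Lemma smooth_fun_lin W W' (L : {linear W -> W'}) (h : M -> W) p :
  continuous L -> smooth_fun_at h p -> smooth_fun_at (fun q => L (h q)) p.
Proof. exact: smooth_near_lin. Qed.

Lemma smooth_vf_ext (Y Z : M -> 'rV[R]_n) p :
  (\forall q \near p, Y q = Z q) -> smooth_vf_at Y p -> smooth_vf_at Z p.
Proof. by move=> YZ; apply: smooth_fun_ext; apply: filterS YZ => q ->. Qed.

Lemma smooth_vf_add (Y Z : M -> 'rV[R]_n) p : smooth_vf_at Y p ->
  smooth_vf_at Z p -> smooth_vf_at (fun q => Y q + Z q) p.
Proof.
move=> Ys Zs; apply: smooth_fun_ext (smooth_near_add Ys Zs).
by apply: nearW => q; rewrite !vcoordE linearD.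
Qed.

Lemma smooth_vf_scale (h : M -> R^o) (Y : M -> 'rV[R]_n) p :
  smooth_fun_at h p -> smooth_vf_at Y p -> smooth_vf_at (fun q => h q *: Y q) p.
Proof.
move=> hs Ys; apply: smooth_fun_ext (smooth_near_scale hs Ys).
by apply: nearW => q; rewrite !vcoordE linearZ.
Qed.

Lemma smooth_vf_opp (Y : M -> 'rV[R]_n) p :
  smooth_vf_at Y p -> smooth_vf_at (fun q => - Y q) p.
Proof.
move=> Ys; apply: smooth_vf_ext (smooth_vf_scale (smooth_fun_cst (-1 : R^o) p) Ys).
by apply: nearW => q; rewrite scaleN1r.
Qed.

Lemma smooth_vf_sum m (Y : 'I_m -> M -> 'rV[R]_n) p :
  (forall j, smooth_vf_at (Y j) p) -> smooth_vf_at (fun q => \sum_j Y j q) p.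
Proof.
elim: m Y => [|m IH] Y Ys.
  have : smooth_vf_at (fun _ : M => (0 : 'rV[R]_n)) p.
    apply: smooth_fun_ext (smooth_fun_cst (0 : 'rV[R]_n) p).
    by apply: nearW => q; rewrite vcoordE linear0.
  by apply: smooth_vf_ext; apply: nearW => q; rewrite big_ord0.
apply: smooth_vf_ext (smooth_vf_add (Ys ord0) (IH _ (fun j => Ys (lift ord0 j)))).
by apply: nearW => q; rewrite big_ord_recl.
Qed.

(** A local extension of the tangent vector [v] at [p], with constant components in the chart at
    [p]; it is used only as a germ at [p]. *)
Definition const_field p (v : 'rV[R]_n) (q : M) : 'rV[R]_n := jac p q q v.

Lemma const_field_at p v : const_field p v p = v.
Proof. by rewrite /const_field jacK//; exact: chart_at_dom. Qed.

Lemma near_vcoord_const_field p v :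
  \forall q \near p, v = vcoord p q (const_field p v q).
Proof.
by apply: filterS (near_chart_dom (chart_at_dom p)) => q pq; rewrite vcoord_jac.
Qed.

Lemma const_field_smooth p v : smooth_vf_at (const_field p v) p.
Proof.
apply: (@smooth_fun_ext _ (fun _ : M => v)); last exact: smooth_fun_cst.
exact: near_vcoord_const_field.
Qed.

Lemma deriv_const_field p v u :
  Defs.deriv (fun q => vcoord p q (const_field p v q)) p u = 0.
Proof.
apply: (@is_deriv_val _ _ p (fun=> 0)); apply: (is_deriv_ext _ (is_deriv_cst v p)).
exact: near_vcoord_const_field.
Qed.

Lemma lie_const_field p v w : lie (const_field p v) (const_field p w) p = 0.
Proof. by rewrite /lie !deriv_const_field subr0. Qed.

Lemma coord_fieldE p j : coord_field p j = const_field p (delta_mx 0 j).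
Proof. by []. Qed.

End ChartCalculus.

(** * Locality of connections and Christoffel symbols *)

Section ConnectionCalculus.
Context (R : realType) (n : nat) (M : manifold R n) (D : connection M).
Implicit Types (Y Z : M -> 'rV[R]_n).

Lemma conn0 p v : D p v (fun=> 0) = 0.
Proof.
have s0 : smooth_vf_at (fun _ : M => (0 : 'rV[R]_n)) p.
  apply: smooth_fun_ext (smooth_fun_cst (0 : 'rV[R]_n) p).
  by apply: nearW => q; rewrite vcoordE linear0.
have := @conn_add _ _ _ D p v _ _ s0 s0.
have -> : (fun q : M => (0 : 'rV[R]_n) + 0) = (fun=> 0).
  by apply/funext => q; rewrite addr0.
by move=> /eqP; rewrite -subr_eq0 opprD addrA subrr sub0r oppr_eq0 => /eqP.
Qed.

(* The indicator function of a neighbourhood of p is smooth at p, so that the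
   Leibniz rule alone makes connections local: no bump function is needed. *)
Lemma conn_local p v Y Z : smooth_vf_at Y p ->
  (\forall q \near p, Y q = Z q) -> D p v Y = D p v Z.
Proof.
move=> Ys YZ; have Zs := smooth_vf_ext YZ Ys.
pose f (q : M) : R^o := (`[< Y q = Z q >])%:R.
have f1 : \forall q \near p, 1 = f q :> R^o.
  by apply: filterS YZ => q /asboolP e; rewrite /f e.
have fp : f p = 1 by rewrite -(nbhs_singleton f1).
have fs : smooth_fun_at f p.
  by apply: (@smooth_fun_ext _ _ _ _ (fun=> 1 : R^o)) => //; exact: smooth_fun_cst.
have df : Defs.deriv f p v = 0.
  apply: (@is_deriv_val _ _ _ _ _ p (fun=> 0)).
  by apply: (@is_deriv_ext _ _ _ _ (fun=> 1 : R^o)) => //; exact: is_deriv_cst.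
have E : (fun q => f q *: Y q) = (fun q => f q *: Z q).
  apply/funext => q; rewrite /f; case: asboolP => [->//|_].
  by rewrite !scale0r.
have := @conn_leibniz _ _ _ D p v _ _ fs Ys.
by rewrite E conn_leibniz// df fp !scale0r !add0r !scale1r.
Qed.

Lemma conn_opp p v Y : smooth_vf_at Y p -> D p v (fun q => - Y q) = - D p v Y.
Proof.
move=> Ys; have -> : (fun q => - Y q) = (fun q => (-1 : R^o) *: Y q).
  by apply/funext => q; rewrite scaleN1r.
rewrite (@conn_leibniz _ _ _ D p v _ _ (smooth_fun_cst (-1 : R^o) p) Ys).
by rewrite (is_deriv_val _ (is_deriv_cst _ p)) scale0r add0r scaleN1r.
Qed.

Lemma conn_sum m p v (Y : 'I_m -> M -> 'rV[R]_n) :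
  (forall j, smooth_vf_at (Y j) p) ->
  D p v (fun q => \sum_j Y j q) = \sum_j D p v (Y j).
Proof.
elim: m Y => [|m IH] Y Ys.
  rewrite big_ord0 -[RHS](conn0 p v); congr (D p v _).
  by apply/funext => q; rewrite big_ord0.
rewrite big_ord_recl -IH// -conn_add//; last by apply: smooth_vf_sum.
by congr (D p v _); apply/funext => q; rewrite big_ord_recl.
Qed.

(** The Christoffel symbols of the chart at [p], taken at [p] and contracted with [v] and [w]; this
    is also the sum occurring in [cov_along]. *)
Definition christoffel (p : M) (v w : 'rV[R]_n) : 'rV[R]_n :=
  \sum_j row_coord j w *: D p v (coord_field p j).

Lemma christoffel_linear p v : linear (christoffel p v).
Proof.
move=> a u w; rewrite /christoffel scaler_sumr -big_split; apply: eq_bigr => j _.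
by rewrite linearP scalerDl scalerA.
Qed.

HB.instance Definition _ p v :=
  GRing.isLinear.Build R 'rV[R]_n 'rV[R]_n _ (christoffel p v)
    (christoffel_linear p v).

(** By locality [Y] may be replaced by its expansion in coordinate fields, to which additivity and
    the Leibniz rule apply. *)
Lemma conn_coord p v Y : smooth_vf_at Y p ->
  D p v Y = Defs.deriv (fun q => vcoord p q (Y q)) p v + christoffel p v (Y p).
Proof.
move=> Ys; pose y (j : 'I_n) (q : M) := row_coord j (vcoord p q (Y q)).
have ys j : smooth_fun_at (y j) p.
  by apply: smooth_fun_lin => //; exact: row_coord_continuous.
have Es j : smooth_vf_at (coord_field p j) p by exact: const_field_smooth.
rewrite (@conn_local p v _ (fun q => \sum_j y j q *: coord_field p j q))//.
  rewrite conn_sum; last by move=> j; exact: smooth_vf_scale.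
  under eq_bigr => j _.
    rewrite conn_leibniz// coord_fieldE const_field_at {2}/y vcoord_id.
    rewrite (is_deriv_val _ (is_deriv_lin (@row_coord_continuous R n j)
      (smooth_is_deriv Ys))).
    over.
  rewrite big_split /=; congr (_ + _).
  rewrite [RHS](row_sum_delta (Defs.deriv _ p v)); exact: eq_bigr.
apply: filterS (near_chart_dom (chart_at_dom p)) => q pq.
rewrite -[LHS](jac_vcoord _ pq) linear_row_sum; exact: eq_bigr.
Qed.

Lemma conn_const_field p v w : D p v (const_field p w) = christoffel p v w.
Proof.
rewrite conn_coord ?deriv_const_field ?add0r ?const_field_at//.
exact: const_field_smooth.
Qed.

(** For fields with constant components the bracket vanishes at [p], so vanishing torsion is exactly
    this symmetry. *)
Lemma christoffel_sym p v w : torsion_free D ->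
  christoffel p v w = christoffel p w v.
Proof.
move=> /(_ _ _ p (const_field_smooth p v) (const_field_smooth p w)).
rewrite /cov !const_field_at !conn_const_field lie_const_field => /eqP.
by rewrite subr_eq0 => /eqP.
Qed.

End ConnectionCalculus.

(** * Fields along a map *)

Section FieldsAlongMap.
Context (R : realType) (m n : nat) (M : manifold R m) (M' : manifold R n).
Context (f : M -> M').
Implicit Types (X Y : M -> 'rV[R]_m) (Z : M -> 'rV[R]_n) (p q : M).

Lemma dmap_linear p : linear (dmap f p).
Proof. by move=> a u v; exact: linearP. Qed.

HB.instance Definition _ p :=
  GRing.isLinear.Build R 'rV[R]_m 'rV[R]_n _ (dmap f p) (dmap_linear p).

Context (fs : smooth_map f).

Lemma dmap_is_deriv p : is_deriv (chart_at (f p) \o f) p (dmap f p).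
Proof. exact: smooth_is_deriv (fs p).2. Qed.

Lemma is_deriv_comp (W : normedModType R) (h : M' -> W) p dh :
  is_deriv h (f p) dh -> is_deriv (h \o f) p (fun v => dh (dmap f p v)).
Proof.
move=> hb; have fp := dmap_is_deriv p.
have : is_diff (chart_at p p) ((h \o chart_inv (chart_at (f p))) \o
    ((chart_at (f p) \o f) \o chart_inv (chart_at p))) (fun v => dh (dmap f p v)).
  apply: (@is_diff_comp R _ _ W _ _ _ _ _ fp).
  by rewrite /= chart_mapK//; exact: chart_at_dom.
apply: near_eq_is_diff.
have bp : \forall q \near p, chart_dom (chart_at (f p)) (f q).
  exact: ((fs p).1 _ (near_chart_dom (chart_at_dom (f p)))).
have := near_chart_inv (chart_at_dom p) bp.
by apply: filterS => y by_ /=; rewrite chart_mapK.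
Qed.

(** Reads [dmap f q] in charts that do not move with [q], so that it can be differentiated in
    [q]. *)
Lemma vcoord_dmap p q v :
  chart_dom (chart_at p) q -> chart_dom (chart_at (f p)) (f q) ->
  vcoord (f p) (f q) (dmap f q v) =
  'd (chart_at (f p) \o f \o chart_inv (chart_at p)) (chart_at p q) (vcoord p q v).
Proof.
move=> pq bq.
have cb : is_deriv (chart_at (f p)) (f q) (jac (f q) (f p) (f q)).
  by apply: differentiableP; apply: transition_differentiable => //; exact: chart_at_dom.
have cf := is_deriv_comp cb.
have [_ E] := is_diff_change_chart pq (chart_at_dom q) cf.
have := congr1 (fun d : _ -> _ => d (vcoord p q v)) E.
by rewrite /= jac_vcoord// => ->.
Qed.

(** In fixed charts the pushed-forward field is the differential of the local expression of [f]
    applied to the components of [Y]; [is_diff_diff_apply] then produces a Hessian term and the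
    image of the derivative of [Y]. *)
Lemma dmap_along_is_deriv p Y : smooth_vf_at Y p ->
  is_deriv (fun q => vcoord (f p) (f q) (dmap f q (Y q))) p
    (fun u => 'd (fun y => 'd (chart_at (f p) \o f \o chart_inv (chart_at p)) y (Y p))
                (chart_at p p) u
            + dmap f p (Defs.deriv (fun q => vcoord p q (Y q)) p u)).
Proof.
move=> Ys; set phi := chart_at (f p) \o f \o chart_inv (chart_at p).
have [U [Uo Up phis]] := (fs p).2.
have [phid dphi] := phis 1.
pose Yh := (fun q => vcoord p q (Y q)) \o chart_inv (chart_at p).
have Yh0 : Yh (chart_at p p) = Y p.
  by rewrite /Yh /= chart_mapK ?vcoord_id//; exact: chart_at_dom.
have := @is_diff_diff_apply R m _ phi Yh _ _ (phid _ Up)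
  (fun v => ((phis 2).2 v).1 _ Up) (smooth_is_deriv Ys).
rewrite Yh0; apply: near_eq_is_diff.
have pn : \forall q \near p, chart_dom (chart_at p) q /\ chart_dom (chart_at (f p)) (f q).
  apply: filterI; first exact: near_chart_dom (chart_at_dom p).
  exact: ((fs p).1 _ (near_chart_dom (chart_at_dom (f p)))).
have := near_chart_inv (chart_at_dom p) pn.
apply: filterS2 (near_chart_invK (chart_at_dom p)) => y yK [yp yb].
have := vcoord_dmap (Y (chart_inv (chart_at p) y)) yp yb.
by rewrite yK => <-.
Qed.

(** Enough for computing [cov_along], and available for [dmap f q (Y q)] directly from
    [dmap_along_is_deriv], without showing that this field is smooth along [f]. *)
Definition along_differentiable Z p :=
  differentiable ((fun q => vcoord (f p) (f q) (Z q)) \o chart_inv (chart_at p))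
    (chart_at p p).

Lemma along_is_deriv Z p : along_differentiable Z p ->
  is_deriv (fun q => vcoord (f p) (f q) (Z q)) p
    (Defs.deriv (fun q => vcoord (f p) (f q) (Z q)) p).
Proof. exact: differentiableP. Qed.

Lemma smooth_along_differentiable Z p :
  smooth_along_at f Z p -> along_differentiable Z p.
Proof. exact: smooth_near_differentiable. Qed.

Lemma dmap_along_differentiable Y p :
  smooth_vf_at Y p -> along_differentiable (fun q => dmap f q (Y q)) p.
Proof. by move=> /dmap_along_is_deriv[]. Qed.

Lemma along_scale_is_deriv (h : M -> R^o) Z p dh :
  is_deriv h p dh -> along_differentiable Z p ->
  is_deriv (fun q => vcoord (f p) (f q) (h q *: Z q)) p
    (fun u => h p *: Defs.deriv (fun q => vcoord (f p) (f q) (Z q)) p u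
              + dh u *: Z p).
Proof.
move=> hp Zp; have := is_deriv_scale hp (along_is_deriv Zp).
rewrite vcoord_id; apply: is_deriv_ext; apply: nearW => q.
by rewrite !vcoordE linearZ.
Qed.

Lemma along_scale_differentiable (h : M -> R^o) Z p dh :
  is_deriv h p dh -> along_differentiable Z p ->
  along_differentiable (fun q => h q *: Z q) p.
Proof. by move=> hp Zp; case: (along_scale_is_deriv hp Zp). Qed.

Context (D : connection M').

Lemma cov_alongE X Z p dZ :
  is_deriv (fun q => vcoord (f p) (f q) (Z q)) p dZ ->
  cov_along D f X Z p = dZ (X p) + christoffel D (f p) (dmap f p (X p)) (Z p).
Proof. by move=> Zp; rewrite /cov_along (is_deriv_val _ Zp). Qed.

Lemma cov_along_add X (Z1 Z2 : M -> 'rV[R]_n) p :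
  along_differentiable Z1 p -> along_differentiable Z2 p ->
  cov_along D f X (fun q => Z1 q + Z2 q) p = cov_along D f X Z1 p + cov_along D f X Z2 p.
Proof.
move=> Zp1 Zp2; have Z12 := is_deriv_add (along_is_deriv Zp1) (along_is_deriv Zp2).
rewrite [LHS](@cov_alongE _ _ _ (fun u =>
    Defs.deriv (fun q => vcoord (f p) (f q) (Z1 q)) p u +
    Defs.deriv (fun q => vcoord (f p) (f q) (Z2 q)) p u)).
  by rewrite linearD addrACA.
by apply: is_deriv_ext Z12; apply: nearW => q; rewrite !vcoordE linearD.
Qed.

Lemma cov_along_scale X (h : M -> R^o) Z p dh :
  is_deriv h p dh -> along_differentiable Z p ->
  cov_along D f X (fun q => h q *: Z q) p =
  dh (X p) *: Z p + h p *: cov_along D f X Z p.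
Proof.
move=> hp Zp; rewrite (cov_alongE _ (along_scale_is_deriv hp Zp)).
by rewrite linearZ /= addrAC addrC scalerDr.
Qed.

(** Parallelism is assumed for ambient fields, whereas [Z] lives only along [f]. Expanding [Z] in
    the ambient coordinate fields reduces the claim to these fields, where the assumption
    applies. *)
Lemma cov_along_tensor (F : tensor11 M') X Z p :
  (forall (U V : M' -> 'rV[R]_n) (b : M'), smooth_vf_at U b -> smooth_vf_at V b ->
     cov D U (fun x => F x (V x)) b = F b (cov D U V b)) ->
  along_differentiable Z p ->
  cov_along D f X (fun q => F (f q) (Z q)) p = F (f p) (cov_along D f X Z p).
Proof.
move=> FD Zp; pose b := f p; set v := dmap f p (X p).
pose G (j : 'I_n) x := vcoord b x (F x (coord_field b j x)).
have Es j : smooth_vf_at (coord_field b j) b by exact: const_field_smooth.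
have Gs j : is_deriv (G j) b (Defs.deriv (G j) b).
  by apply: smooth_is_deriv; exact: tensor11_smooth (Es j).
have Gb j : G j b = F b (delta_mx 0 j).
  by rewrite /G vcoord_id coord_fieldE const_field_at.
have Zj j := is_deriv_lin (@row_coord_continuous R n j) (along_is_deriv Zp).
have FZ := is_deriv_sum (fun j => is_deriv_scale (Zj j) (is_deriv_comp (Gs j))).
have bn : \forall q \near p, chart_dom (chart_at b) (f q).
  exact: ((fs p).1 _ (near_chart_dom (chart_at_dom b))).
have hatE : \forall q \near p,
    \sum_j row_coord j (vcoord b (f q) (Z q)) *: (G j \o f) q =
    vcoord b (f q) (F (f q) (Z q)).
  apply: filterS bn => q bq; rewrite /= -[in RHS](jac_vcoord (Z q) bq).
  rewrite [X in F _ X]linear_row_sum linear_sum [RHS]vcoordE linear_sum.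
  apply: eq_bigr => j _.
  by rewrite !vcoordE !linearZ.
rewrite (cov_alongE _ (is_deriv_ext hatE FZ)).
rewrite -/b -/v.
(* Parallelism of [F] tested on a coordinate field, in the direction of the constant extension of
   [v]. *)
have FE j : F b (D b v (coord_field b j)) =
    Defs.deriv (G j) b v + christoffel D b v (F b (delta_mx 0 j)).
  have := FD _ _ b (const_field_smooth b v) (Es j).
  rewrite /cov const_field_at => <-.
  rewrite conn_coord; last exact: tensor11_smooth.
  by rewrite coord_fieldE const_field_at.
rewrite (cov_alongE _ (along_is_deriv Zp)) -/b -/v linearD.
have -> : F b (christoffel D b v (Z p)) =
    \sum_j row_coord j (Z p) *: Defs.deriv (G j) b v
    + christoffel D b v (F b (Z p)).
  rewrite [X in _ + christoffel D b v (F b X)]row_sum_delta.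
  rewrite {1}/christoffel !linear_sum -big_split /=; apply: eq_bigr => j _.
  by rewrite !linearZ FE /= scalerDr.
rewrite addrA; congr (_ + _).
rewrite [X in F b X](row_sum_delta (Defs.deriv _ p (X p))) linear_sum addrC -big_split.
apply: eq_bigr => j _.
by rewrite linearZ /= Gb vcoord_id.
Qed.

(** The Hessian terms cancel by symmetry of second differentials, the Christoffel terms by vanishing
    torsion; the image of the bracket remains. *)
Lemma cov_along_torsion X Y p : torsion_free D ->
  smooth_vf_at X p -> smooth_vf_at Y p ->
  cov_along D f X (fun q => dmap f q (Y q)) p
  - cov_along D f Y (fun q => dmap f q (X q)) p = dmap f p (lie X Y p).
Proof.
move=> tf Xs Ys.
have [U [Uo Up phis]] := (fs p).2.
pose d2f u w := 'd (fun y =>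
  'd (chart_at (f p) \o f \o chart_inv (chart_at p)) y w) (chart_at p p) u.
have sym : d2f (X p) (Y p) = d2f (Y p) (X p).
  exact: second_diff_sym (Y p) (X p) Uo Up (phis 2).
have EY : cov_along D f X (fun q => dmap f q (Y q)) p = d2f (X p) (Y p)
    + dmap f p (Defs.deriv (fun q => vcoord p q (Y q)) p (X p))
    + christoffel D (f p) (dmap f p (X p)) (dmap f p (Y p)).
  by rewrite (cov_alongE _ (dmap_along_is_deriv Ys)).
have EX : cov_along D f Y (fun q => dmap f q (X q)) p = d2f (Y p) (X p)
    + dmap f p (Defs.deriv (fun q => vcoord p q (X q)) p (Y p))
    + christoffel D (f p) (dmap f p (Y p)) (dmap f p (X p)).
  by rewrite (cov_alongE _ (dmap_along_is_deriv Xs)).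
rewrite EX EY sym (christoffel_sym _ (dmap f p (Y p)) _ tf).
rewrite opprD addrACA subrr addr0 opprD addrACA subrr add0r.
by rewrite /lie linearB.
Qed.

End FieldsAlongMap.

(** * Dual connections and hypersurfaces *)

Section DualConnection.
Context (R : realType) (n : nat) (M : manifold R n) (g : metric M).
Implicit Types (X Y Z : M -> 'rV[R]_n) (u v w : 'rV[R]_n).

Lemma metricDl p u v w : g p (u + v) w = g p u w + g p v w.
Proof. by have := metric_linear g p 1 u v w; rewrite scale1r mul1r. Qed.

Lemma metric0l p w : g p 0 w = 0.
Proof. by apply: (@addrI _ (g p 0 w)); rewrite -metricDl !addr0. Qed.

Lemma metricZl p a u w : g p (a *: u) w = a * g p u w.
Proof. by have := metric_linear g p a u 0 w; rewrite addr0 metric0l addr0. Qed.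

Lemma metricBl p u v w : g p (u - v) w = g p u w - g p v w.
Proof. by rewrite metricDl -scaleN1r metricZl mulN1r. Qed.

Lemma metricBr p u v w : g p w (u - v) = g p w u - g p w v.
Proof. by rewrite !(Defs.metric_sym _ _ w) metricBl. Qed.

Lemma metric_definite p v : g p v v = 0 -> v = 0.
Proof.
by move=> gv; apply/eqP/negPn/negP => /(metric_pos g p); rewrite gv ltxx.
Qed.

Context (D Ds : connection M) (dual : dual_connection g D Ds).

(** Let [T] be the difference of the torsions of [Ds] and [D]. Duality turns [g(T, T)] into the
    difference of the covariant derivatives of [g] at [(X, T, Y)] and [(Y, T, X)], which vanishes by
    total symmetry; definiteness gives [T = 0]. *)
Lemma dual_torsion_free : statistical g D -> torsion_free Ds.
Proof.
move=> [tf sym] X Y p Xs Ys.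
pose T q := cov Ds X Y q - cov D X Y q - (cov Ds Y X q - cov D Y X q).
(* [T] itself serves as a test field, so it must be smooth at [p]. *)
have Ts : smooth_vf_at T p.
  have cs (D0 : connection M) := @conn_smooth _ _ _ D0.
  apply: smooth_vf_add; last apply: smooth_vf_opp;
    apply: smooth_vf_add; try apply: smooth_vf_opp; exact: cs.
have CE U V : smooth_vf_at U p -> smooth_vf_at V p ->
    cov_metric D g U T V p = g p (T p) (cov Ds U V p - cov D U V p).
  move=> Us Vs; rewrite /cov_metric (dual Ts Vs Us) metricBr.
  by rewrite addrK.
have : g p (T p) (T p) = 0.
  rewrite {2}/T metricBr -!CE//.
  have [_ ->] := sym X T Y p Xs Ts Ys.
  have [-> _] := sym X Y T p Xs Ys Ts.
  by have [_ ->] := sym Y X T p Ys Xs Ts; rewrite subrr.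
move=> /metric_definite /eqP; rewrite subr_eq0 => /eqP E.
rewrite -(tf X Y p Xs Ys).
apply/eqP; rewrite -subr_eq0; apply/eqP.
transitivity (T p); last by rewrite /T E subrr.
by apply/rowP => j; rewrite /T !mxE; ring.
Qed.

(** Differentiate [g(F T, Y) = g(T, Fs Y)] by duality on both sides, with [T] the defect of
    parallelism of [Fs] on [Y]: what remains is [g(T, T) = 0]. *)
Lemma dual_parallel (F Fs : tensor11 M) : adjoint_tensor g F Fs ->
  (forall X Y p, smooth_vf_at X p -> smooth_vf_at Y p ->
     cov D X (fun q => F q (Y q)) p = F p (cov D X Y p)) ->
  forall X Y p, smooth_vf_at X p -> smooth_vf_at Y p ->
     cov Ds X (fun q => Fs q (Y q)) p = Fs p (cov Ds X Y p).
Proof.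
move=> adj DF X Y p Xs Ys.
have cs (D0 : connection M) := @conn_smooth _ _ _ D0.
have FsY : smooth_vf_at (fun q => Fs q (Y q)) p by exact: tensor11_smooth.
pose T q := cov Ds X (fun q => Fs q (Y q)) q - Fs q (cov Ds X Y q).
have Ts : smooth_vf_at T p.
  apply: smooth_vf_add; first exact: cs.
  by apply: smooth_vf_opp; apply: tensor11_smooth; exact: cs.
have FTs : smooth_vf_at (fun q => F q (T q)) p by exact: tensor11_smooth.
have := dual FTs Ys Xs.
have -> : (fun q => g q (F q (T q)) (Y q) : R^o) =
    (fun q => g q (T q) (Fs q (Y q)) : R^o).
  by apply/funext => q; rewrite adj.
rewrite (dual Ts FsY Xs) DF// !adj => /addIr E.
apply/eqP; rewrite -subr_eq0; apply/eqP/(@metric_definite p).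
by rewrite -/(T p) {2}/T metricBr E subrr.
Qed.

End DualConnection.

(** * Sign change of the 1-form *)

Section OppositeForm.
Context (R : realType) (n : nat) (M : manifold R n).

Lemma is_deriv_opp (W : normedModType R) (h : M -> W) p dh :
  is_deriv h p dh -> is_deriv (fun q => - h q) p (fun v => - dh v).
Proof. exact: is_diffN. Qed.

Lemma opp_form_smooth (k : one_form M) (X : M -> 'rV[R]_n) p :
  smooth_vf_at X p -> smooth_fun_at (fun q => (\- k q) (X q) : R^o) p.
Proof.
move=> /(one_form_smooth k) ks.
have : smooth_fun_at (fun q => (-1 : R^o) *: (k q (X q) : R^o)) p.
  exact: smooth_near_scale (smooth_fun_cst (-1 : R^o) p) ks.
apply: smooth_fun_ext; apply: nearW => q; exact: scaleN1r.
Qed.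

Definition opp_form (k : one_form M) : one_form M :=
  @OneForm R n M (fun p => \- k p) (@opp_form_smooth k).

(** The connection enters [dform] only through the antisymmetrized covariant derivative, which is
    assumed to be the same for [D] and [Ds]. *)
Lemma dform_opp (D Ds : connection M) (k : one_form M) X Y p :
  smooth_vf_at X p -> smooth_vf_at Y p ->
  cov D X Y p - cov D Y X p = cov Ds X Y p - cov Ds Y X p ->
  dform Ds (opp_form k) X Y p = - dform D k X Y p.
Proof.
move=> Xs Ys E; rewrite /dform /cov_form /=.
have dk Z : smooth_vf_at Z p ->
    Defs.deriv (fun q => - k q (Z q) : R^o) p = - Defs.deriv (fun q => k q (Z q) : R^o) p.
  move=> Zs; apply/funext => v.
  exact: is_deriv_val v (is_deriv_opp (smooth_is_deriv (one_form_smooth k Zs))).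
have := congr1 (k p) E; rewrite !linearB /= !dk// !fctE => kE.
have -> : k p (cov D X Y p) = k p (cov Ds X Y p) - k p (cov Ds Y X p) + k p (cov D Y X p).
  by rewrite -kE subrK.
by ring.
Qed.

End OppositeForm.

(** * Covariant derivatives and curvature on a tangential hypersurface *)

Section Hypersurface.
Context (R : realType) (n : nat) (M' : manifold R n.+1) (g : metric M').
Context (M : manifold R n) (f : M -> M') (fi : immersion f).
Context (N : M -> 'rV[R]_n.+1) (Nn : unit_normal f g N).
Implicit Types X Y : M -> 'rV[R]_n.
Local Notation h := (induced_metric f g).

(** Pairing with the unit normal isolates the coefficients; injectivity of the differential then
    identifies the tangent vectors. *)
Lemma tangent_normal_inj p v w (a b : R) :
  dmap f p v + a *: N p = dmap f p w + b *: N p -> v = w /\ a = b.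
Proof.
have [_ N1 NT] := Nn => E.
have ab : a = b.
  have := congr1 (fun z => g (f p) z (N p)) E.
  by rewrite !metricDl !metricZl !(Defs.metric_sym _ _ (dmap f p _)) !NT !add0r N1 !mulr1.
by split=> //; apply: (fi.2 p); move: E; rewrite ab => /addIr.
Qed.

Lemma induced_sym p v w : h p v w = h p w v.
Proof. exact: Defs.metric_sym. Qed.

Lemma induced_metricBl p u v w : h p (u - v) w = h p u w - h p v w.
Proof. by rewrite /induced_metric linearB metricBl. Qed.

Lemma normal_differentiable p : along_differentiable f N p.
Proof. by apply: smooth_along_differentiable; case: Nn. Qed.

Lemma tensor_field (A : tensor11 M) X :
  vector_field X -> vector_field (fun q => A q (X q)).
Proof. by move=> Xs p; exact: tensor11_smooth. Qed.

Lemma cov_field (D : connection M) X Y :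
  vector_field X -> vector_field Y -> vector_field (cov D X Y).
Proof. by move=> Xs Ys p; exact: conn_smooth. Qed.

Context (D' : connection M') (D : connection M) (A As : tensor11 M).
Context (k : one_form M).
Context (GW : gauss_weingarten f g N D' D A As (fun p v => k p v)).

(** These are the tangential and normal parts of [cov_along_torsion] once the Gauss formula is
    inserted. *)
Lemma gauss_torsion X Y p : torsion_free D' -> vector_field X -> vector_field Y ->
  cov D X Y p - cov D Y X p = lie X Y p /\
  h p (As p (X p)) (Y p) = h p (As p (Y p)) (X p).
Proof.
move=> tf Xs Ys; have := cov_along_torsion fi.1 tf (Xs p) (Ys p).
rewrite !GW.1// => /eqP; rewrite subr_eq addrA -linearD => /eqP.
move=> /tangent_normal_inj[E ->]; split=> //.
by rewrite E addrK.
Qed.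

Context (F : tensor11 M').
Context (FD : forall (U V : M' -> 'rV[R]_n.+1) (b : M'), smooth_vf_at U b ->
  smooth_vf_at V b -> cov D' U (fun x => F x (V x)) b = F b (cov D' U V b)).
Context (xi : M -> 'rV[R]_n) (xis : vector_field xi).
Context (FN : forall p, F (f p) (N p) = dmap f p (xi p)).
Context (phi : tensor11 M) (etas : one_form M).
Context (FT : forall p v, F (f p) (dmap f p v) = dmap f p (phi p v) + etas p v *: N p).

(** The tangential part of the derivative of [F N], computed once by the Gauss formula and once as
    [F] applied to the Weingarten formula. *)
Lemma cov_xi X p : vector_field X ->
  cov D X xi p = - phi p (A p (X p)) + k p (X p) *: xi p.
Proof.
move=> Xs; have := cov_along_tensor fi.1 X FD (normal_differentiable p).
have -> : (fun q => F (f q) (N q)) = (fun q => dmap f q (xi q)) by apply/funext.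
rewrite GW.1// GW.2// linearD linearN linearZ /= FT FN.
rewrite opprD -scaleNr addrAC -linearN -linearZ -linearD.
by move=> /tangent_normal_inj[].
Qed.

Lemma dmap_normal_combine p u v (c1 c2 c3 c6 : R) :
  dmap f p (u - c3 *: v) + (c1 + c2 + c6) *: N p =
  dmap f p u + c1 *: N p +
    (c2 *: N p + (- (c3 *: dmap f p v) + c6 *: N p)).
Proof.
rewrite linearB linearZ /= !scalerDl -!addrA; congr (_ + _).
by rewrite [LHS]addrCA; congr (_ + _); rewrite [LHS]addrCA.
Qed.

(** The same comparison for [F] of a tangent field: [A] enters by differentiating [N] in the normal
    part of [F Y], and [xi] as the image under [F] of the normal term in the Gauss formula. *)
Lemma cov_phi X Y p : vector_field X -> vector_field Y ->
  cov D X (fun q => phi q (Y q)) p = phi p (cov D X Y p)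
    + etas p (Y p) *: A p (X p) + h p (As p (X p)) (Y p) *: xi p.
Proof.
move=> Xs Ys.
have := cov_along_tensor fi.1 X FD (dmap_along_differentiable fi.1 (Ys p)).
have -> : (fun q => F (f q) (dmap f q (Y q))) =
    (fun q => dmap f q (phi q (Y q)) + etas q (Y q) *: N q) by apply/funext.
have phiY := tensor_field phi Ys.
have es := smooth_is_deriv (one_form_smooth etas (Ys p)).
have Np := normal_differentiable p.
rewrite (cov_along_add D' X (dmap_along_differentiable fi.1 (phiY p))
  (along_scale_differentiable es Np)) (cov_along_scale D' X es Np).
rewrite !GW.1// GW.2// [F _ _]linearD [F _ (_ *: _)]linearZ /= FT FN.
rewrite scalerDr scalerN scalerA.
(* The scalars are abstracted to regroup both sides as tangent plus normal; only [c3] and [c5] occur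
   in the tangential parts. *)
set c1 := h _ _ _; set c2 := Defs.deriv _ _ _; set c3 := etas p (Y p).
set c4 := etas p _; set c5 := h _ _ _; set c6 := c3 * _.
move=> E; have {}E := etrans (dmap_normal_combine _ _ _ c1 c2 c3 c6) E; move: E.
have -> : dmap f p (phi p (cov D X Y p)) + c4 *: N p + c5 *: dmap f p (xi p) =
    dmap f p (phi p (cov D X Y p) + c5 *: xi p) + c4 *: N p.
  by rewrite linearD linearZ /= addrAC.
move=> /tangent_normal_inj[/eqP + _].
by rewrite subr_eq => /eqP ->; rewrite addrAC.
Qed.

Lemma cov_cov_xi X Y p : vector_field X -> vector_field Y ->
  cov D X (cov D Y xi) p =
  - (phi p (cov D X (fun q => A q (Y q)) p) + etas p (A p (Y p)) *: A p (X p)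
     + h p (As p (X p)) (A p (Y p)) *: xi p)
  + (Defs.deriv (fun q => k q (Y q) : R^o) p (X p) *: xi p
     + k p (Y p) *: (- phi p (A p (X p)) + k p (X p) *: xi p)).
Proof.
move=> Xs Ys; have AY := tensor_field A Ys; have phiAY := tensor_field phi AY.
have ks := one_form_smooth k (Ys p).
(* [cov_xi] holds at every point, hence as an equality of fields that can be differentiated
   again. *)
have -> : cov D Y xi = (fun q => - phi q (A q (Y q)) + k q (Y q) *: xi q).
  by apply/funext => q; rewrite cov_xi.
rewrite {1}/cov conn_add; last first.
- exact: smooth_vf_scale.
- exact: smooth_vf_opp.
rewrite conn_opp// conn_leibniz// -!/(cov D X _ p).
by rewrite cov_phi// cov_xi.
Qed.

(** After antisymmetrization the products of two values of [k] cancel and its derivatives assemble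
    into [dform]. Self-adjointness of [A] is a hypothesis because it comes from the Gauss formula of
    the dual connection. *)
Lemma curvature_xi X Y p : torsion_free D' -> vector_field X -> vector_field Y ->
  (forall U V, vector_field U -> vector_field V ->
    h p (A p (U p)) (V p) = h p (A p (V p)) (U p)) ->
  curvature D X Y xi p =
    - phi p (cov_shape D A (fun p v => k p v) X Y p)
    + phi p (cov_shape D A (fun p v => k p v) Y X p)
    - etas p (A p (Y p)) *: A p (X p)
    + etas p (A p (X p)) *: A p (Y p)
    - (h p (commutator A As p (X p)) (Y p) - dform D k X Y p) *: xi p.
Proof.
move=> tf Xs Ys symA; rewrite /curvature !cov_cov_xi//.
have XY := cov_field D Xs Ys; have YX := cov_field D Ys Xs.
(* Vanishing torsion of [D] replaces the bracket by covariant derivatives, so that [cov_xi] applies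
   to this term too. *)
have -> : cov D (lie X Y) xi p = cov D (cov D X Y) xi p - cov D (cov D Y X) xi p.
  rewrite {1}/cov -(gauss_torsion p tf Xs Ys).1.
  have := conn_linear D (xis p) (-1) (cov D Y X p) (cov D X Y p).
  by rewrite !scaleN1r => E; rewrite [in LHS]addrC E [LHS]addrC.
rewrite !cov_xi// /dform /cov_form /cov_shape /commutator induced_metricBl.
have AX := tensor_field A Xs; have AY := tensor_field A Ys.
(* Self-adjointness of [A] and [As] brings the commutator to the products of [As] and [A] values
   left by the second derivatives. *)
rewrite (symA _ _ (tensor_field As Xs) Ys) (induced_sym p (A p (Y p))).
rewrite (gauss_torsion p tf AX Ys).2.
rewrite !linearB !linearZ /=.
by apply/rowP => j; rewrite !mxE; ring.
Qed.

End Hypersurface.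

Unset Implicit Arguments.
Set Strict Implicit.

Theorem proposition5p4
  (R : realType) (n : nat)
  (* the locally product-like statistical manifold *)
  (M' : manifold R n.+1) (g' : metric M') (D' D's : connection M')
  (F Fs : tensor11 M')
  (hF : locally_product_like g' D' F)
  (hdual : dual_connection g' D' D's)
  (hFs : adjoint_tensor g' F Fs)
  (* the hypersurface and its unit normal *)
  (M : manifold R n) (f : M -> M') (hf : immersion f)
  (N : M -> 'rV[R]_n.+1) (hN : unit_normal f g' N)
  (* it is tangential: F N and F^* N are tangent to M *)
  (xi xis : M -> 'rV[R]_n) (hxi : vector_field xi) (hxis : vector_field xis)
  (hFN : forall p, F (f p) (N p) = dmap f p (xi p))
  (hFsN : forall p, Fs (f p) (N p) = dmap f p (xis p))
  (* decomposition of F X and F^* X *)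
  (phi phis : tensor11 M) (eta etas : one_form M)
  (hphi : forall p v,
     F (f p) (dmap f p v) = dmap f p (phi p v) + etas p v *: N p)
  (hphis : forall p v,
     Fs (f p) (dmap f p v) = dmap f p (phis p v) + eta p v *: N p)
  (* induced connections, shape operators and 1-form *)
  (D Ds : connection M) (A As : tensor11 M) (kappa : one_form M)
  (hGW : gauss_weingarten f g' N D' D A As (fun p v => kappa p v))
  (hGWs : gauss_weingarten f g' N D's Ds As A (fun p v => - kappa p v)) :
  let g := induced_metric f g' in
  forall (X Y : M -> 'rV[R]_n), vector_field X -> vector_field Y ->
  forall p : M,
    curvature D X Y xi p =
      - phi p (cov_shape D A (fun p v => kappa p v) X Y p)
      + phi p (cov_shape D A (fun p v => kappa p v) Y X p)
      - etas p (A p (Y p)) *: A p (X p)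
      + etas p (A p (X p)) *: A p (Y p)
      - (g p (commutator A As p (X p)) (Y p) - dform D kappa X Y p) *: xi p
    /\
    curvature Ds X Y xis p =
      - phis p (cov_shape Ds As (fun p v => - kappa p v) X Y p)
      + phis p (cov_shape Ds As (fun p v => - kappa p v) Y X p)
      - eta p (As p (Y p)) *: As p (X p)
      + eta p (As p (X p)) *: As p (Y p)
      + (g p (commutator A As p (X p)) (Y p) - dform D kappa X Y p) *: xis p.
Proof.
move=> g X Y Xs Ys p; rewrite {}/g.
have [stat FF FD0] := hF; have tf := stat.1.
have FD (U V : M' -> 'rV[R]_n.+1) (b : M') : smooth_vf_at U b ->
    smooth_vf_at V b -> cov D' U (fun x => F x (V x)) b = F b (cov D' U V b).
  by move=> Us Vs; apply/eqP; rewrite -subr_eq0; apply/eqP; exact: FD0.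
have FsD := dual_parallel hdual hFs FD.
have tfs := dual_torsion_free hdual stat.
(* The opposite of [kappa] is presented as a smooth 1-form, so that the hypersurface lemmas apply to
   the dual data. *)
have hGWs' : gauss_weingarten f g' N D's Ds As A (fun p v => opp_form kappa p v).
  exact: hGWs.
have symAs U V : vector_field U -> vector_field V ->
    induced_metric f g' p (As p (U p)) (V p) = induced_metric f g' p (As p (V p)) (U p).
  by move=> Us Vs; exact: (gauss_torsion hf hN hGW p tf Us Vs).2.
have symA U V : vector_field U -> vector_field V ->
    induced_metric f g' p (A p (U p)) (V p) = induced_metric f g' p (A p (V p)) (U p).
  by move=> Us Vs; exact: (gauss_torsion hf hN hGWs' p tfs Us Vs).2.
split; first exact: (curvature_xi hf hN hGW FD hxi hFN hphi tf Xs Ys symA).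
rewrite (curvature_xi hf hN hGWs' FsD hxis hFsN hphis tfs Xs Ys symAs).
(* Both induced connections are torsion free, so their antisymmetrized derivatives equal the same
   bracket. *)
rewrite (@dform_opp _ _ _ D Ds) ?(Xs p) ?(Ys p)//; last first.
  rewrite (gauss_torsion hf hN hGW p tf Xs Ys).1.
  by rewrite (gauss_torsion hf hN hGWs' p tfs Xs Ys).1.
(* Exchanging [A] and [As] reverses the commutator, and [dform] has changed sign as well; this turns
   the minus before the last term into a plus. *)
rewrite /commutator !induced_metricBl; congr (_ + _); rewrite -scaleNr.
congr (_ *: _).
by rewrite !opprB addrC.
Qed.
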